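(* Let $X$ be a coarsely convex metric space with data $\lambda,k,E,C,\theta,\mathcal L$, where $\mathcal L$ is chosen such that for any two points of $X$ there is exactly one quasi-geodesic segment in $\mathcal L$ connecting the first to the second, and such that for every $x\in X$ the segment in $\mathcal L$ connecting $x$ to itself is the constant path. Let $p\in X$ be an arbitrary base point and for $x\in X$ denote by $\gamma_x\colon[0,t_x]\to X$ the quasi-geodesic segment in $\mathcal L$ from $p$ to $x$. Then the formula $$H(x,n):=\begin{cases}\gamma_x(n)&\text{for }n\le t_x,\\ x&\text{for }n\ge t_x\end{cases}$$ defines a coherent and expanding combing on $X$.
   Context: $\mathbb N=\{0,1,2,\dots\}$. A $(\lambda,k)$-quasi-geodesic segment in a metric space $(X,d)$ is a (not necessarily continuous) map $\gamma\colon[0,a]\to X$ with $\lambda^{-1}|t-s|-k\le d(\gamma(t),\gamma(s))\le\lambda|t-s|+k$ for all $s,t\in[0,a]$. $X$ is coarsely convex (Fukaya–Oguni) if there are constants $\lambda\ge1$, $k\ge0$, $E\ge1$, $C\ge0$, a non-decreasing function $\theta\colon\mathbb R_{\ge0}\to\mathbb R_{\ge0}$ and a family $\mathcal L$ of $(\lambda,k)$-quasi-geodesic segments such that: (1) for any $v,w\in X$ there is $\gamma\colon[0,a]\to X$ in $\mathcal L$ with $\gamma(0)=v$, $\gamma(a)=w$; (2) for all $\gamma\colon[0,a]\to X$ and $\eta\colon[0,b]\to X$ in $\mathcal L$, all $t\in[0,a]$, $s\in[0,b]$ and $0\le c\le1$: $d(\gamma(ct),\eta(cs))\le cE\,d(\gamma(t),\eta(s))+(1-c)E\,d(\gamma(0),\eta(0))+C$;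 (3) for all such $\gamma,\eta,t,s$: $|t-s|\le\theta\big(d(\gamma(0),\eta(0))+d(\gamma(t),\eta(s))\big)$. A combing on $X$ starting at $p\in X$ is a map $H\colon X\times\mathbb N\to X$, $H_n(x):=H(x,n)$, such that: (i) $H_0(x)=p=H_n(p)$ for all $x,n$; (ii) for every bounded $K\subset X$ there is $N$ with $H_n(x)=x$ for all $x\in K$, $n\ge N$; (iii) for every $r\ge0$ there is $s\ge0$ such that $d(x,y)\le r$, $|m-n|\le r$ imply $d(H_m(x),H_n(y))\le s$. $H$ is coherent if there is $R_{coh}\ge0$ with $d(H_m(H_n(x)),H_m(x))\le R_{coh}$ for all $x$ and all $m\le n$. $H$ is expanding if there is $R_{exp}>0$ such that for all $r>0$, $n\in\mathbb N$ there is a bounded $K_{r,n}\subset X$ with $d(H_n(y),H_n(x))\le R_{exp}$ whenever $x\notin K_{r,n}$, $d(x,y)\le r$. *)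

(* Defs.v *)
From HB Require Import structures.
From mathcomp Require Import all_boot all_order all_algebra.
From mathcomp Require Import all_classical all_reals topology.

Set Implicit Arguments.
Unset Strict Implicit.
Unset Printing Implicit Defensive.

Import Order.TTheory GRing.Theory Num.Theory.

Local Open Scope classical_set_scope.
Local Open Scope ring_scope.

(* A map [0, seg_len] -> X. It is stored as a function on all of R whose values
   outside [0, seg_len] are meaningless: no definition below depends on them,
   and maps are compared with [seg_eq], not with Leibniz equality. *)
Record segment (R : realType) (X : Type) := Segment {
  seg_len : R;
  seg_len_ge0 : 0 <= seg_len;
  seg_map :> R -> X }.

Definition seg_eq (R : realType) (X : Type) (g h : segment R X) : Prop :=
  seg_len g = seg_len h /\
  (forall t : R, 0 <= t <= seg_len g -> g t = h t).

Definition connects (R : realType) (X : Type) (g : segment R X) (v w : X) :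
    Prop :=
  g 0 = v /\ g (seg_len g) = w.

Definition constant_segment (R : realType) (X : Type) (g : segment R X)
    (x : X) : Prop :=
  forall t : R, 0 <= t <= seg_len g -> g t = x.

Definition quasi_geodesic (R : realType) (X : metricType R) (lam k : R)
    (g : segment R X) : Prop :=
  forall t s : R, 0 <= t <= seg_len g -> 0 <= s <= seg_len g ->
    lam^-1 * `|t - s| - k <= mdist (g t) (g s) <= lam * `|t - s| + k.

(* [theta] stands for a map R_{>=0} -> R_{>=0}; only its values at nonnegative
   reals are constrained and used. *)
Record coarsely_convex_data (R : realType) (X : metricType R)
    (lam k E C : R) (theta : R -> R) (L : set (segment R X)) : Prop := {
  cc_lam : 1 <= lam;
  cc_k : 0 <= k;
  cc_E : 1 <= E;
  cc_C : 0 <= C;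
  cc_theta_ge0 : forall u : R, 0 <= u -> 0 <= theta u;
  cc_theta_homo : forall u v : R, 0 <= u -> u <= v -> theta u <= theta v;
  cc_quasi_geodesic : forall g, L g -> quasi_geodesic lam k g;
  cc_connect : forall v w : X, exists g, L g /\ connects g v w;
  cc_convex : forall g h, L g -> L h ->
    forall t s c : R, 0 <= t <= seg_len g -> 0 <= s <= seg_len h ->
      0 <= c <= 1 ->
      mdist (g (c * t)) (h (c * s)) <=
        c * E * mdist (g t) (h s) + (1 - c) * E * mdist (g 0) (h 0) + C;
  cc_param : forall g h, L g -> L h ->
    forall t s : R, 0 <= t <= seg_len g -> 0 <= s <= seg_len h ->
      `|t - s| <= theta (mdist (g 0) (h 0) + mdist (g t) (h s)) }.

Definition uniquely_connecting (R : realType) (X : Type)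
    (L : set (segment R X)) : Prop :=
  forall v w : X, exists g, [/\ L g, connects g v w &
    forall h, L h -> connects h v w -> seg_eq g h].

Definition metric_bounded (R : realType) (X : metricType R) (K : set X) :
    Prop :=
  exists M : R, forall x y : X, K x -> K y -> mdist x y <= M.

(* [H x n] is H_n(x). *)
Record combing (R : realType) (X : metricType R) (p : X) (H : X -> nat -> X) :
    Prop := {
  combing_start : forall x, H x 0%N = p;
  combing_base : forall n, H p n = p;
  combing_end : forall K : set X, metric_bounded K ->
    exists N : nat, forall x n, K x -> (N <= n)%N -> H x n = x;
  combing_controlled : forall r : R, 0 <= r -> exists s : R, 0 <= s /\
    forall (x y : X) (m n : nat),
      mdist x y <= r -> `|m%:R - n%:R : R| <= r -> mdist (H x m) (H y n) <= s }.

Definition coherent (R : realType) (X : metricType R) (H : X -> nat -> X) :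
    Prop :=
  exists Rcoh : R, 0 <= Rcoh /\
    forall (x : X) (m n : nat), (m <= n)%N ->
      mdist (H (H x n) m) (H x m) <= Rcoh.

Definition expanding (R : realType) (X : metricType R) (H : X -> nat -> X) :
    Prop :=
  exists Rexp : R, 0 < Rexp /\
    forall (r : R) (n : nat), 0 < r ->
      exists K : set X, metric_bounded K /\
        forall x y : X, ~ K x -> mdist x y <= r ->
          mdist (H y n) (H x n) <= Rexp.

Definition segment_combing (R : realType) (X : Type) (gamma : X -> segment R X)
    (x : X) (n : nat) : X :=
  if n%:R <= seg_len (gamma x) then gamma x n%:R else x.

(* The two cases of the formula overlap when n is the length of the segment;
   they agree there, so the second one holds whenever the length is <= n. *)
Lemma segment_combing_late (R : realType) (X : Type) (gamma : X -> segment R X)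
    (p x : X) (n : nat) :
  connects (gamma x) p x -> seg_len (gamma x) <= n%:R ->
  segment_combing gamma x n = x.
Proof.
move=> [_ gx] len_n; rewrite /segment_combing; case: ifP => // n_len.
have -> // : n%:R = seg_len (gamma x) by apply/eqP; rewrite eq_le n_len.
Qed.

(* Main.v *)
Require Import Defs.
From mathcomp Require Import all_boot all_order all_algebra.
From mathcomp Require Import all_classical all_reals topology.
From mathcomp Require Import lra.
Import Order.TTheory GRing.Theory Num.Theory.
Local Open Scope classical_set_scope.
Local Open Scope ring_scope.

(** Write [t_x] for the length of [gamma x].  The combing point [H x n] is
    [gamma x] evaluated at [min n t_x], so all three properties compare values
    of two segments of [L] that start at [p].  One estimate does this.  Let [g]
    and [h] be such segments with [d(g t, h s) <= r], and let [0 <= c <= 1].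
    Coarse convexity with equal starting points gives
    [d(g (c t), h (c s)) <= c E r + C]; the parameter [c s] differs from [c t]
    by at most [c theta(r)] because [|t - s| <= theta(r)]; and moving the
    parameter of [h] from [c s] to some [v] costs at most
    [lam |c s - v| + k].  Altogether
      [d(g (c t), h v) <= c (E r + lam theta(r)) + C + k + lam |c t - v|],
    which is [fellow_travel].

    Control of the combing: apply it at the endpoints [x] and [y]; the two
    cut-off parameters differ by at most [|m - n| + theta(r)]
    ([fellow_travel_min]).  Coherence: [gamma x] cut off at [min n t_x] and the
    segment of [z = H x n] both end at [z], so the same estimate applies with
    [r = 0].  Expansion: for fixed [n] the factor is [c = n / t_x], which tends
    to [0] as [x] leaves bounded sets, and eventually absorbs
    [E r + lam theta(r)]; what remains is [1 + C + k], independent of [r] and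
    [n].  Lengths of segments and distances from [p] control each other by the
    quasi-geodesic inequalities, which also gives the condition that [H]
    eventually fixes bounded sets.  Finally [H_n(p) = p] because [gamma p] is
    constant: its length may be positive, so this is not automatic. *)

(** * Truncated parameters and lengths of quasi-geodesics *)

Lemma dist_min_le (R : realType) (a b t s : R) :
  `|Num.min a t - Num.min b s| <= `|a - b| + `|t - s|.
Proof.
have ab := ler_norm (a - b); have ba := ler_norm (b - a).
have ts := ler_norm (t - s); have st := ler_norm (s - t).
rewrite (distrC b) in ba; rewrite (distrC s) in st.
rewrite ler_norml; case: (lerP a t) => ?; case: (lerP b s) => ?;
  apply/andP; split; lra.
Qed.

Lemma min_itv {R : realType} {a l : R} :
  0 <= a -> 0 <= l -> 0 <= Num.min a l <= l.
Proof. by move=> a0 l0; rewrite le_min a0 l0 ge_min lexx orbT. Qed.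

(** Includes [t = 0], where the segment is a point and any ratio does; this
    keeps the degenerate case out of the estimates below. *)
Lemma min_ratio {R : realType} {a t : R} : 0 <= a -> 0 <= t ->
  exists2 c, 0 <= c <= 1 & c * t = Num.min a t.
Proof.
move=> a0 t0; exists (Num.min a t / t); last first.
  have [->|tN0] := eqVneq t 0; last by rewrite divfK.
  by rewrite mulr0; apply/esym/min_idPr.
have /andP[m0 mt] := min_itv a0 t0.
rewrite divr_ge0//=; have [->|tN0] := eqVneq t 0; first by rewrite invr0 mulr0.
by rewrite ler_pdivrMr ?mul1r// lt_def tN0.
Qed.

Lemma segment_combing_min {R : realType} {X : Type} {gamma : X -> segment R X}
    {p x : X} (n : nat) : connects (gamma x) p x ->
  segment_combing gamma x n = gamma x (Num.min n%:R (seg_len (gamma x))).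
Proof.
move=> gx; case: (lerP n%:R (seg_len (gamma x))) => n_len.
  by rewrite /segment_combing n_len.
by rewrite (segment_combing_late gx (ltW n_len)); case: gx.
Qed.

Lemma quasi_geodesic_len_le {R : realType} {X : metricType R} {lam k : R}
    {g : segment R X} : 1 <= lam -> quasi_geodesic lam k g ->
  seg_len g <= lam * (mdist (g 0) (g (seg_len g)) + k).
Proof.
move=> lam1 qg; have len0 := seg_len_ge0 g.
have /andP[+ _] := qg (seg_len g) 0 ltac:(by rewrite len0 lexx)
  ltac:(by rewrite len0 lexx).
rewrite subr0 ger0_norm// metric_sym lerBlDr ler_pdivrMl//; lra.
Qed.

Lemma quasi_geodesic_dist_le {R : realType} {X : metricType R} {lam k : R}
    {g : segment R X} : quasi_geodesic lam k g ->
  mdist (g 0) (g (seg_len g)) <= lam * seg_len g + k.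
Proof.
move=> qg; have len0 := seg_len_ge0 g.
have /andP[_] := qg (seg_len g) 0 ltac:(by rewrite len0 lexx)
  ltac:(by rewrite len0 lexx).
by rewrite subr0 ger0_norm// metric_sym.
Qed.

(** * Two segments with a common starting point *)

Section CommonStart.
Context {R : realType} {X : metricType R} {lam k E C : R} {theta : R -> R}.
Context {L : set (segment R X)}.
Hypothesis hX : coarsely_convex_data lam k E C theta L.

Lemma param_le {g h : segment R X} {t s r : R} :
  L g -> L h -> g 0 = h 0 ->
  0 <= t <= seg_len g -> 0 <= s <= seg_len h -> mdist (g t) (h s) <= r ->
  `|t - s| <= theta r.
Proof.
move=> Lg Lh gh0 ht hs d_r.
apply: le_trans (cc_param hX Lg Lh ht hs) _.
by rewrite gh0 mdistxx add0r; apply: cc_theta_homo hX _ _ (mdist_ge0 _ _) d_r.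
Qed.

(** The factor [c] in front of [E * r + lam * theta r] is what makes the combing
    expanding, and the freedom in [v] lets the two segments be cut off at
    different parameters. *)
Lemma fellow_travel {g h : segment R X} {t s r c v : R} :
  L g -> L h -> g 0 = h 0 ->
  0 <= t <= seg_len g -> 0 <= s <= seg_len h -> mdist (g t) (h s) <= r ->
  0 <= c <= 1 -> 0 <= v <= seg_len h ->
  mdist (g (c * t)) (h v) <=
    c * (E * r + lam * theta r) + (C + k + lam * `|c * t - v|).
Proof.
move=> Lg Lh gh0 ht hs d_r hc hv.
have c_ge0 : 0 <= c by case/andP: hc.
have lam0 : 0 <= lam := le_trans ler01 (cc_lam hX).
have E0 : 0 <= E := le_trans ler01 (cc_E hX).
have hcs : 0 <= c * s <= seg_len h.
  case/andP: hs => s0 sh; case/andP: hc => _ c1.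
  by rewrite mulr_ge0//= (le_trans _ sh)// ler_piMl.
have convex := cc_convex hX Lg Lh ht hs hc.
rewrite gh0 mdistxx mulr0 addr0 in convex.
have /andP[_ slide] := cc_quasi_geodesic hX Lh hcs hv.
have csv : `|c * s - v| <= c * theta r + `|c * t - v|.
  have -> : c * s - v = c * (s - t) + (c * t - v) by lra.
  apply: le_trans (ler_normD _ _) _; rewrite lerD2r normrM ger0_norm//.
  by rewrite ler_wpM2l// distrC (param_le Lg Lh gh0 ht hs d_r).
have := ler_wpM2l lam0 csv.
have := ler_wpM2l (mulr_ge0 c_ge0 E0) d_r.
have := metric_triangle (g (c * t)) (h (c * s)) (h v); lra.
Qed.

Lemma fellow_travel_min {g h : segment R X} {t s r a b : R} :
  L g -> L h -> g 0 = h 0 ->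
  0 <= t <= seg_len g -> 0 <= s <= seg_len h -> mdist (g t) (h s) <= r ->
  0 <= a -> 0 <= b ->
  mdist (g (Num.min a t)) (h (Num.min b s)) <=
    E * r + lam * theta r + (C + k + lam * (`|a - b| + theta r)).
Proof.
move=> Lg Lh gh0 ht hs d_r a0 b0.
have lam0 : 0 <= lam := le_trans ler01 (cc_lam hX).
have r0 : 0 <= r := le_trans (mdist_ge0 _ _) d_r.
have [t0 s0] : 0 <= t /\ 0 <= s by case/andP: ht; case/andP: hs.
have [c hc ct] := min_ratio a0 t0.
have hv : 0 <= Num.min b s <= seg_len h.
  case/andP: hs => _; case/andP: (min_itv b0 s0) => -> /=; exact: le_trans.
have := fellow_travel Lg Lh gh0 ht hs d_r hc hv; rewrite ct => travel.
apply: le_trans travel _; apply: lerD.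
  rewrite ler_piMl//; last by case/andP: hc.
  rewrite addr_ge0// mulr_ge0// ?(cc_theta_ge0 hX)//.
  exact: le_trans ler01 (cc_E hX).
rewrite lerD2l ler_wpM2l// (le_trans (dist_min_le _ _ _ _ _))// lerD2l.
exact: param_le Lg Lh gh0 ht hs d_r.
Qed.

(** * The combing along the segments from the base point *)

Context {p : X} {gamma : X -> segment R X}.
Hypothesis hgamma : forall x : X, L (gamma x) /\ connects (gamma x) p x.

Local Notation H := (segment_combing gamma).
Local Notation len x := (seg_len (gamma x)).

Let gammaL x : L (gamma x). Proof. by case: (hgamma x). Qed.

Let gamma0 x : gamma x 0 = p. Proof. by case: (hgamma x) => _ []. Qed.

Let gamma_len x : gamma x (len x) = x. Proof. by case: (hgamma x) => _ []. Qed.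

Let gamma00 x y : gamma x 0 = gamma y 0. Proof. by rewrite !gamma0. Qed.

Let HE x n : H x n = gamma x (Num.min n%:R (len x)).
Proof. by case: (hgamma x) => _ /segment_combing_min. Qed.

Let len_itv x : 0 <= len x <= len x. Proof. by rewrite seg_len_ge0 lexx. Qed.

Lemma len_le x : len x <= lam * (mdist p x + k).
Proof.
have := quasi_geodesic_len_le (cc_lam hX) (cc_quasi_geodesic hX (gammaL x)).
by rewrite gamma0 gamma_len.
Qed.

Lemma dist_base_le x : mdist p x <= lam * len x + k.
Proof.
have := quasi_geodesic_dist_le (cc_quasi_geodesic hX (gammaL x)).
by rewrite gamma0 gamma_len.
Qed.

Lemma segment_combing_end (K : set X) : metric_bounded K ->
  exists N : nat, forall x n, K x -> (N <= n)%N -> H x n = x.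
Proof.
move=> [M KM]; have lam0 : 0 <= lam := le_trans ler01 (cc_lam hX).
have [[z Kz]|K0] := pselect (exists z, K z); last first.
  by exists 0%N => x n Kx _; case: K0; exists x.
exists (Num.bound `|lam * (mdist p z + M + k)|) => x n Kx N_n.
apply: segment_combing_late (proj2 (hgamma x)) _.
apply: le_trans (len_le x) _.
apply: (@le_trans _ _ (lam * (mdist p z + M + k))).
  rewrite ler_wpM2l// lerD2r (le_trans (metric_triangle _ z _))// lerD2l.
  exact: KM.
apply: le_trans (ler_norm _) _.
by apply/ltW/(lt_le_trans (archi_boundP (normr_ge0 _))); rewrite ler_nat.
Qed.

Lemma segment_combing_controlled (r : R) : 0 <= r ->
  exists s : R, 0 <= s /\ forall (x y : X) (m n : nat),
    mdist x y <= r -> `|m%:R - n%:R : R| <= r -> mdist (H x m) (H y n) <= s.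
Proof.
move=> r0; have lam0 : 0 <= lam := le_trans ler01 (cc_lam hX).
pose s := E * r + lam * theta r + (C + k + lam * (r + theta r)).
have bound x y (m n : nat) : mdist x y <= r -> `|m%:R - n%:R : R| <= r ->
    mdist (H x m) (H y n) <= s.
  move=> xy_r mn_r; rewrite !HE.
  apply: le_trans (fellow_travel_min (gammaL x) (gammaL y) (gamma00 x y)
    (len_itv x) (len_itv y) _ (ler0n _ _) (ler0n _ _)) _.
    by rewrite !gamma_len; exact: xy_r.
  by rewrite /s !lerD2l ler_wpM2l// lerD2r.
exists s; split=> //; apply: le_trans (mdist_ge0 (H p 0) (H p 0)) _.
by apply: bound; rewrite ?mdistxx ?subrr ?normr0.
Qed.

Lemma segment_combing_coherent : coherent H.
Proof.
(* The bound of [fellow_travel_min] with [r = 0] and [a = b = m]. *)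
pose Rcoh := E * 0 + lam * theta 0 + (C + k + lam * (0 + theta 0)).
have bound x (m n : nat) : (m <= n)%N ->
    mdist (H (H x n) m) (H x m) <= Rcoh.
  move=> mn; set z := H x n.
  (* As [m <= n], [H x m] lies on the part of [gamma x] that ends at [z]; this
     is the truncated segment that [gamma z] is compared with. *)
  have mE : Num.min m%:R (len x) =
            Num.min m%:R (Num.min n%:R (len x)).
    by rewrite minA; congr Num.min; apply/esym/min_idPl; rewrite ler_nat.
  rewrite (HE z m) (HE x m) mE /Rcoh -(@normr0 _ R) -(subrr (m%:R : R)).
  apply: fellow_travel_min (gammaL z) (gammaL x) (gamma00 z x)
    (len_itv z) (min_itv (ler0n _ n) (seg_len_ge0 _)) _
    (ler0n _ _) (ler0n _ _).
  by rewrite gamma_len -HE mdistxx subrr normr0.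
exists Rcoh; split=> //.
exact: le_trans (mdist_ge0 _ _) (bound p 0%N 0%N (leqnn _)).
Qed.

Lemma segment_combing_expanding : expanding H.
Proof.
have lam0 : 0 <= lam := le_trans ler01 (cc_lam hX).
have C0 := cc_C hX; have k0 := cc_k hX.
exists (1 + (C + k)); split=> [|r n r0]; first by lra.
have th0 : 0 <= theta r := cc_theta_ge0 hX (ltW r0).
pose B := E * r + lam * theta r.
have B0 : 0 <= B.
  rewrite addr_ge0// mulr_ge0// ?(ltW r0)//.
  exact: le_trans ler01 (cc_E hX).
have nB0 : 0 <= n%:R * B by rewrite mulr_ge0.
(* If [gamma x] is longer than [T], then [gamma y], whose length differs by at
   most [theta r], is still at least [n] long, and [n / len x * B <= 1]; the
   summand 1 makes [len x] positive. *)
pose T := n%:R + theta r + n%:R * B + 1.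
have n0 : 0 <= n%:R :> R by [].
exists [set x | mdist p x <= lam * T + k]; split.
  exists (lam * T + k + (lam * T + k)) => x y /= px py.
  have := metric_triangle x p y; rewrite (metric_sym x p); lra.
move=> x y /= /negP; rewrite -ltNge => farx xy_r.
have T_len : T < len x.
  rewrite ltNge; apply/negP => /(ler_wpM2l lam0).
  have := dist_base_le x; lra.
have xy_len : mdist (gamma x (len x)) (gamma y (len y)) <= r.
  by rewrite !gamma_len.
have := param_le (gammaL x) (gammaL y) (gamma00 x y)
  (len_itv x) (len_itv y) xy_len.
move=> /(le_trans (ler_norm _)) len_xy.
have [nx ny] : n%:R <= len x /\ n%:R <= len y.
  by rewrite /T in T_len; split; lra.
have lenx_gt0 : 0 < len x by rewrite /T in T_len; lra.
have hc : 0 <= n%:R / len x <= 1.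
  by rewrite (divr_ge0 n0 (ltW lenx_gt0))/= ler_pdivrMr// mul1r.
have hv : 0 <= (n%:R : R) <= len y by rewrite n0.
have := fellow_travel (gammaL x) (gammaL y) (gamma00 x y)
  (len_itv x) (len_itv y) xy_len hc hv.
rewrite divfK ?gt_eqF// subrr normr0 mulr0 addr0 => travel.
rewrite metric_sym !HE !(min_idPl _)//; apply: le_trans travel _.
rewrite lerD2r mulrAC ler_pdivrMr// mul1r -/B.
by rewrite /T in T_len; lra.
Qed.

End CommonStart.

Theorem lemma3p26 (R : realType) (X : metricType R)
    (lam k E C : R) (theta : R -> R) (L : set (segment R X))
    (hX : coarsely_convex_data lam k E C theta L)
    (hL : uniquely_connecting L)
    (hconst : forall (x : X) (g : segment R X),
      L g -> connects g x x -> constant_segment g x)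
    (p : X) (gamma : X -> segment R X)
    (hgamma : forall x : X, L (gamma x) /\ connects (gamma x) p x) :
  [/\ combing p (segment_combing gamma),
      coherent (segment_combing gamma) &
      expanding (segment_combing gamma)].
Proof.
split.
- split.
  + move=> x; have [_ gx] := hgamma x.
    rewrite (segment_combing_min 0 gx) (min_idPl (seg_len_ge0 _)).
    by case: gx.
  + move=> n; have [Lp gp] := hgamma p.
    rewrite (segment_combing_min n gp).
    exact: hconst Lp gp _ (min_itv (ler0n _ n) (seg_len_ge0 _)).
  + exact (segment_combing_end hX hgamma).
  + exact (segment_combing_controlled hX hgamma).
- exact (segment_combing_coherent hX hgamma).
- exact (segment_combing_expanding hX hgamma).
Qed.
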